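(* Let $X\subseteq\mathbb{Z}^2$ be a connected two-dimensional digital image with basepoint $x_0$. Then the digital fundamental group $\pi_1(X;x_0)$ is a free group.
   Context: A digital image is a finite subset $X\subseteq\mathbb{Z}^n$ (for some $n$) with the adjacency relation $x\sim_X y$ iff $|x_i-y_i|\le 1$ for all $i=1,\ldots,n$ (reflexive and symmetric). A based digital image also has a chosen basepoint $x_0\in X$. A function $f\colon X\to Y$ of digital images is continuous if $x\sim_X x'$ implies $f(x)\sim_Y f(x')$. For $N\ge 0$, $I_N=\{0,1,\ldots,N\}\subseteq\mathbb{Z}$. A based digital image $X$ is connected if for every $x\in X$ there is a continuous $\alpha\colon I_N\to X$ (some $N\ge0$) with $\alpha(0)=x_0$, $\alpha(N)=x$. Products carry the adjacency $(x,y)\sim(x',y')$ iff $x\sim x'$ and $y\sim y'$. A based loop of length $N$ in $X$ is a continuous $\alpha\colon I_N\to X$ with $\alpha(0)=\alpha(N)=x_0$. Based loops $\alpha,\beta\colon I_M\to X$ of the same length are based homotopic as based loops, $\alpha\approx\beta$, if for some $R\ge1$ there is a continuous $H\colon I_M\times I_R\to X$ with $H(s,0)=\alpha(s)$, $H(s,R)=\beta(s)$ and $H(0,t)=H(M,t)=x_0$ for all $s,t$. For $k\ge1$ let $\rho_k\colon I_{kN+k-1}\to I_N$, $\rho_k(i)=\lfloor i/k\rfloor$. Based loops $\alpha\colon I_M\to X$, $\beta\colon I_N\to X$ are subdivision-based homotopic if for some $k,l\ge1$ with $k(M+1)=l(N+1)$ we have $\alpha\circ\rho_k\approx\beta\circ\rho_l$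 as based loops. This is an equivalence relation on the based loops of all lengths; the digital fundamental group $\pi_1(X;x_0)$ is the set of classes $[\alpha]$. It is a group under $[\alpha]\cdot[\beta]=[\alpha\cdot\beta]$, where for $\alpha\colon I_M\to X$, $\beta\colon I_N\to X$ the loop $\alpha\cdot\beta\colon I_{M+N+1}\to X$ equals $\alpha(t)$ for $0\le t\le M$ and $\beta(t-(M+1))$ for $M+1\le t\le M+N+1$; the identity is the class of constant loops, and inverses are given by reversing loops. (The trivial group counts as a free group, on the empty set.) *)

(* Defs.v *)
From HB Require Import structures.
From mathcomp Require Import all_boot all_order all_algebra.
From mathcomp Require Import generic_quotient finmap boolp zify.

Set Implicit Arguments.
Unset Strict Implicit.
Unset Printing Implicit Defensive.

Import Order.TTheory GRing.Theory Num.Theory.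
Local Open Scope quotient_scope.

Definition adjacent (n : nat) (x y : 'rV[int]_n) : bool :=
  [forall i, (`|x ord0 i - y ord0 i| <= 1)%R].

Definition image_adj (n : nat) (X : {fset 'rV[int]_n}) : rel X :=
  fun x y => adjacent (val x) (val y).

(* The digital interval I_N = {0, ..., N} is encoded as 'I_N.+1. *)
Definition interval_adj (N : nat) : rel 'I_N.+1 :=
  fun s t => (`|(s : nat)%:Z - (t : nat)%:Z| <= 1)%R.

Definition prod_adj (A B : Type) (eA : rel A) (eB : rel B) : rel (A * B) :=
  fun p q => eA p.1 q.1 && eB p.2 q.2.

Definition digital_continuous (A B : Type) (eA : rel A) (eB : rel B)
    (f : A -> B) : Prop :=
  forall x x', eA x x' -> eB (f x) (f x').

Definition digital_connected (n : nat) (X : {fset 'rV[int]_n}) (x0 : X) : Prop :=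
  forall x : X, exists (N : nat) (a : 'I_N.+1 -> X),
    [/\ digital_continuous (@interval_adj N) (@image_adj n X) a,
        a ord0 = x0 & a ord_max = x].

Section Loops.
Context (n : nat) (X : {fset 'rV[int]_n}) (x0 : X).

Definition is_based_loop (N : nat) (a : 'I_N.+1 -> X) : Prop :=
  [/\ digital_continuous (@interval_adj N) (@image_adj n X) a,
      a ord0 = x0 & a ord_max = x0].

Record based_loop := BasedLoop {
  loop_len : nat;
  loop_fun :> 'I_loop_len.+1 -> X;
  loopP : is_based_loop loop_fun }.

HB.instance Definition _ := gen_eqMixin based_loop.
HB.instance Definition _ := gen_choiceMixin based_loop.

Definition loop_homotopic (M : nat) (a b : 'I_M.+1 -> X) : Prop :=
  exists R : nat, (1 <= R)%N /\
  exists H : 'I_M.+1 * 'I_R.+1 -> X,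
    [/\ digital_continuous (prod_adj (@interval_adj M) (@interval_adj R))
          (@image_adj n X) H,
        forall s, H (s, ord0) = a s /\ H (s, ord_max) = b s &
        forall t, H (ord0, t) = x0 /\ H (ord_max, t) = x0].

(* The map rho_k : I_P -> I_N; only meaningful when P = kN + k - 1, i.e. when
   P + 1 = k (N + 1), in which case i %/ k <= N for every i in I_P. *)
Definition rho (k P N : nat) : 'I_P.+1 -> 'I_N.+1 := fun i => inord (i %/ k).

Definition subdivision_homotopic (a b : based_loop) : Prop :=
  exists k l P : nat,
    [/\ (1 <= k)%N, (1 <= l)%N, P.+1 = (k * (loop_len a).+1)%N,
        P.+1 = (l * (loop_len b).+1)%N &
        loop_homotopic (a \o @rho k P (loop_len a)) (b \o @rho l P (loop_len b))].

Definition concat_fun (M N : nat) (a : 'I_M.+1 -> X) (b : 'I_N.+1 -> X) :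
    'I_(M + N + 1).+1 -> X :=
  fun t => if (t <= M)%N then a (inord t) else b (inord (t - M.+1)).

Definition reverse_fun (M : nat) (a : 'I_M.+1 -> X) : 'I_M.+1 -> X :=
  fun t => a (rev_ord t).

Definition adj := @image_adj n X.

Lemma adjxx x : adj x x.
Proof. by apply/forallP => i; rewrite subrr normr0. Qed.

Lemma adjC x y : adj x y -> adj y x.
Proof. by move/forallP=> h; apply/forallP => i; rewrite distrC. Qed.

(* The proofs that pi1 is a group use maps on nat, of which only the values on
   [0, M] matter, in place of maps on 'I_M.+1. *)
Definition close (s s' : nat) := (s <= s'.+1) && (s' <= s.+1).
Definition contN M (a : nat -> X) :=
  forall s s', s <= M -> s' <= M -> close s s' -> adj (a s) (a s').
Definition homN M (a b : nat -> X) :=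
  exists R (H : nat -> nat -> X),
    [/\ forall s s' t t', s <= M -> s' <= M -> t <= R -> t' <= R ->
          close s s' -> close t t' -> adj (H s t) (H s' t'),
        forall s, s <= M -> H s 0 = a s /\ H s R = b s &
        forall t, t <= R -> H 0 t = x0 /\ H M t = x0].

Lemma interval_adjE M (s t : 'I_M.+1) : interval_adj s t = close s t.
Proof. by rewrite /interval_adj /close; lia. Qed.

Definition nat_of M (a : 'I_M.+1 -> X) : nat -> X := fun s => a (inord s).

Lemma inord_ord0 M : inord 0 = ord0 :> 'I_M.+1.
Proof. by apply: val_inj; rewrite /= inordK. Qed.

Lemma inord_max M : inord M = ord_max :> 'I_M.+1.
Proof. by apply: val_inj; rewrite /= inordK. Qed.

Lemma homN_ext M a a' b b' : (forall s, s <= M -> a s = a' s) ->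
  (forall s, s <= M -> b s = b' s) -> homN M a b -> homN M a' b'.
Proof.
move=> ea eb [R [H [h1 h2 h3]]]; exists R, H; split => // s sM.
by rewrite -ea // -eb //; exact: h2.
Qed.

Lemma homNP M (a b : 'I_M.+1 -> X) :
  loop_homotopic a b <-> homN M (nat_of a) (nat_of b).
Proof.
split=> [[R [R1 [H [h1 h2 h3]]]]|[R [H [h1 h2 h3]]]].
  exists R, (fun s t => H (inord s, inord t)); split.
  - move=> s s' t t' ? ? ? ? ss tt; apply: h1.
    by rewrite /prod_adj /= !interval_adjE !inordK // ss tt.
  - by move=> s sM; rewrite inord_ord0 inord_max; exact: h2.
  - by move=> t tR; rewrite inord_ord0 inord_max; exact: h3.
exists R.+1; split=> //.
exists (fun p : 'I_M.+1 * 'I_R.+2 => H p.1 (minn p.2 R)); split.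
- move=> [s t] [s' t'] /andP[]; rewrite !interval_adjE /= /close => ss tt.
  have := ltn_ord s; have := ltn_ord s'; rewrite !ltnS => ? ?.
  by apply: h1 => //; rewrite /close; lia.
- move=> s; have sM : s <= M by rewrite -ltnS.
  have [e1 e2] := h2 s sM.
  by rewrite /= min0n (minn_idPr _) // e1 e2 /nat_of inord_val.
- by move=> t; apply: h3; rewrite geq_minr.
Qed.

Lemma isloopNP M (a : 'I_M.+1 -> X) : is_based_loop a <->
  [/\ contN M (nat_of a), nat_of a 0 = x0 & nat_of a M = x0].
Proof.
rewrite /nat_of inord_ord0 inord_max; split=> -[h1 h2 h3]; split=> //.
  by move=> s s' ? ? ss; apply: h1; rewrite interval_adjE !inordK.
move=> s s'; rewrite interval_adjE => ss.
by have := h1 s s'; rewrite !inord_val; apply => //; rewrite -ltnS.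
Qed.

Lemma homN_refl M a : contN M a -> a 0 = x0 -> a M = x0 -> homN M a a.
Proof.
move=> ca a0 aM; exists 0, (fun s _ => a s); split=> //.
by move=> s s' t t' sM s'M _ _ ss _; exact: ca.
Qed.

Lemma homN_sym M a b : homN M a b -> homN M b a.
Proof.
move=> [R [H [h1 h2 h3]]]; exists R, (fun s t => H s (R - t)); split.
- move=> s s' t t' ? ? ? ? ss; rewrite /close => tt.
  by apply: h1 => //; rewrite ?/close; lia.
- by move=> s sM; have [e1 e2] := h2 s sM; rewrite subn0 subnn e1 e2.
- by move=> t tR; apply: h3; lia.
Qed.

Lemma homN_trans M a b c : homN M a b -> homN M b c -> homN M a c.
Proof.
move=> [R [H [h1 h2 h3]]] [R' [H' [h1' h2' h3']]].
exists (R + R'), (fun s t => if t <= R then H s t else H' s (t - R)).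
have glue s : s <= M -> H s R = H' s 0.
  by move=> sM; rewrite (h2 s sM).2 (h2' s sM).1.
split.
- move=> s s' t t' sM s'M tR t'R ss tt; move: (tt); rewrite /close => tt'.
  case: (leqP t R) => tR1; case: (leqP t' R) => tR2.
  + exact: h1.
  + have -> : t = R by lia.
    by rewrite glue //; apply: h1' => //; rewrite ?/close; lia.
  + have -> : t' = R by lia.
    by rewrite glue //; apply: h1' => //; rewrite ?/close; lia.
  + by apply: h1' => //; rewrite ?/close; lia.
- move=> s sM; rewrite (h2 s sM).1; split=> //.
  case: leqP => h; last by rewrite addKn (h2' s sM).2.
  have R0 : R' = 0 by lia.
  by move: (h2' s sM).2; rewrite R0 addn0 glue.
- by move=> t tR; case: leqP => h; [exact: h3|apply: h3'; lia].
Qed.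

(* Precomposition of a homotopy with a continuous map of intervals. *)
Definition cmap L M (f : nat -> nat) := (forall s, s <= L -> f s <= M) /\
  (forall s s', s <= L -> s' <= L -> close s s' -> close (f s) (f s')).

Lemma homN_comp L M f a b : cmap L M f -> f 0 = 0 -> f L = M ->
  homN M a b -> homN L (a \o f) (b \o f).
Proof.
move=> [fM fc] f0 fL [R [H [h1 h2 h3]]]; exists R, (fun s t => H (f s) t); split.
- by move=> s s' t t' sL s'L tR t'R ss tt; apply: h1; auto.
- by move=> s sL; apply: h2; auto.
- by move=> t tR; rewrite f0 fL; exact: h3.
Qed.

Lemma contN_comp L M f a : cmap L M f -> contN M a -> contN L (a \o f).
Proof. by move=> [fM fc] ca s s' ? ? ?; apply: ca; auto. Qed.

Lemma cmap_comp L M N f g : cmap L M f -> cmap M N g -> cmap L N (g \o f).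
Proof. by move=> [f1 f2] [g1 g2]; split=> [s ?|s s' ? ? ?] /=; auto. Qed.

Lemma cmap_div k M P : P.+1 = k * M.+1 -> cmap P M (fun i => i %/ k).
Proof.
move=> e; have k0 : 0 < k by case: k e.
split=> [s sP|s s' _ _ /andP[h1 h2]].
  by rewrite -ltnS ltn_divLR // mulnC -e ltnS.
have step u v : u <= v.+1 -> u %/ k <= (v %/ k).+1.
  move=> uv; have -> : (v %/ k).+1 = (v + k) %/ k.
    by rewrite divnDr ?dvdnn // divnn k0 addn1.
  by apply: leq_div2r; lia.
by rewrite /close !step.
Qed.

Lemma div_max k M P : P.+1 = k * M.+1 -> P %/ k = M.
Proof.
move=> e; have k0 : 0 < k by case: k e.
have -> : P = M * k + k.-1 by lia.
by rewrite divnMDl // divn_small ?addn0 // prednK.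
Qed.

Lemma reparam_le M a L f g : contN M a -> cmap L M f -> cmap L M g ->
  (forall s, s <= L -> f s <= g s) -> f 0 = g 0 -> f L = g L ->
  a (f 0) = x0 -> a (f L) = x0 -> homN L (a \o f) (a \o g).
Proof.
move=> ca [f1 f2] [g1 g2] fg e0 eL a0 aL.
exists M, (fun s t => a (maxn (f s) (minn (g s) t))); split.
- move=> s s' t t' sL s'L tM t'M ss tt.
  have := f1 _ sL; have := f1 _ s'L; have := g1 _ sL; have := g1 _ s'L.
  have := f2 _ _ sL s'L ss; have := g2 _ _ sL s'L ss.
  move: tt; rewrite /close => *; apply: ca; rewrite ?/close; lia.
- move=> s sL; have := f1 _ sL; have := g1 _ sL; have := fg _ sL => ? ? ?.
  by split=> /=; congr (a _); lia.
- move=> t tM; rewrite -e0 -eL; split; [rewrite -[RHS]a0|rewrite -[RHS]aL];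
    by congr (a _); lia.
Qed.

Lemma reparam M a L f g : contN M a -> cmap L M f -> cmap L M g ->
  f 0 = g 0 -> f L = g L ->
  a (f 0) = x0 -> a (f L) = x0 -> homN L (a \o f) (a \o g).
Proof.
move=> ca cf cg e0 eL a0 aL.
have ch : cmap L M (fun s => maxn (f s) (g s)).
  case: cf cg => [f1 f2] [g1 g2]; split=> [s sL|s s' sL s'L ss].
    by rewrite geq_max f1 // g1.
  by move: (f2 _ _ sL s'L ss) (g2 _ _ sL s'L ss); rewrite /close; lia.
apply: (@homN_trans _ _ (a \o (fun s => maxn (f s) (g s)))).
  apply: (reparam_le ca cf ch _ _ _ a0 aL) => /= [s _||].
  - exact: leq_maxl.
  - by rewrite -e0 maxnn.
  - by rewrite -eL maxnn.
rewrite e0 in a0; rewrite eL in aL; apply: homN_sym.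
apply: (reparam_le ca cg ch _ _ _ a0 aL) => /= [s _||].
- exact: leq_maxr.
- by rewrite e0 maxnn.
- by rewrite eL maxnn.
Qed.

Definition subN M N (a b : nat -> X) := exists k l P,
  [/\ P.+1 = k * M.+1, P.+1 = l * N.+1 &
      homN P (fun i => a (i %/ k)) (fun i => b (i %/ l))].

Lemma rho_nat k P M (a : 'I_M.+1 -> X) s : s <= P ->
  nat_of (a \o @rho k P M) s = nat_of a (s %/ k).
Proof. by move=> sP; rewrite /nat_of /rho /= inordK. Qed.

Lemma subNP (a b : based_loop) : subdivision_homotopic a b <->
  subN (loop_len a) (loop_len b) (nat_of a) (nat_of b).
Proof.
split=> [[k [l [P [k1 l1 ek el]]]]|[k [l [P [ek el]]]]] h.
  exists k, l, P; split=> //; move/homNP: h.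
  by apply: homN_ext => s sP; rewrite rho_nat.
exists k, l, P; split=> //; first by case: k ek {h}.
  by case: l el {h}.
by apply/homNP; apply: homN_ext h => s sP; rewrite rho_nat.
Qed.

Definition isloopN M a := [/\ contN M a, a 0 = x0 & a M = x0].

Lemma loopN (a : based_loop) : isloopN (loop_len a) (nat_of a).
Proof. exact/isloopNP/loopP. Qed.

Lemma subN_sym M N a b : subN M N a b -> subN N M b a.
Proof. by move=> [k [l [P [ek el /homN_sym h]]]]; exists l, k, P. Qed.

Lemma subN_trans M N Q a b c : subN M N a b -> subN N Q b c -> subN M Q a c.
Proof.
move=> [k [l [P [ek el h]]]] [k' [l' [P' [ek' el' h']]]].
have gt0 x y z : x.+1 = y * z -> 0 < y by case: y.
have [k0 l0 k'0 l'0] := And4 (gt0 _ _ _ ek) (gt0 _ _ _ el) (gt0 _ _ _ ek')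
  (gt0 _ _ _ el').
pose T := (k' * P.+1).-1.
have eT : T.+1 = k' * P.+1 by rewrite prednK // muln_gt0 k'0.
have eT' : T.+1 = l * P'.+1 by rewrite eT el ek' mulnCA.
exists (k' * k), (l * l'), T; split; first by rewrite eT ek mulnA.
  by rewrite eT' el' mulnA.
apply: (@homN_trans _ _ (fun i => b (i %/ (k' * l)))).
  have := homN_comp (cmap_div eT) (div0n _) (div_max eT) h.
  by apply: homN_ext => s _ /=; rewrite divnMA.
have := homN_comp (cmap_div eT') (div0n _) (div_max eT') h'.
by apply: homN_ext => s _ /=; rewrite -divnMA // (mulnC l).
Qed.

(* A loop is subdivision homotopic to any of its reparametrizations that
   agree at the endpoints. *)
Lemma subN_reparam M L a f g : isloopN M a ->
  cmap L M f -> cmap L M g -> f 0 = g 0 -> f L = g L ->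
  a (f 0) = x0 -> a (f L) = x0 -> subN L L (a \o f) (a \o g).
Proof.
move=> [ca _ _] cf cg e0 eL a0 aL; exists 1, 1, L; rewrite mul1n; split=> //.
have := reparam ca cf cg e0 eL a0 aL.
by apply: homN_ext => s _; rewrite divn1.
Qed.

Lemma subN_reparam_end M L a f : isloopN M a ->
  cmap L M f -> f 0 = 0 -> f L = M -> subN L M (a \o f) a.
Proof.
move=> [ca a0 aM] cf f0 fL.
pose P := (M.+1 * L.+1).-1.
have eP : P.+1 = M.+1 * L.+1 by rewrite prednK.
have eP' : P.+1 = L.+1 * M.+1 by rewrite eP mulnC.
exists M.+1, L.+1, P; split=> //.
apply: (@reparam M a P (f \o (fun i => i %/ M.+1)) (fun i => i %/ L.+1)) => //.
- exact: cmap_comp (cmap_div eP) cf.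
- exact: cmap_div.
- by rewrite /comp (div_max eP) (div_max eP').
- by rewrite /comp div0n f0.
- by rewrite /comp (div_max eP) fL.
Qed.

Lemma subN_refl M a : isloopN M a -> subN M M a a.
Proof. by move=> la; apply: (@subN_reparam_end M M a id). Qed.

Lemma subN_ext M N a a' b b' : (forall s, s <= M -> a s = a' s) ->
  (forall s, s <= N -> b s = b' s) -> subN M N a b -> subN M N a' b'.
Proof.
move=> ea eb [k [l [P [ek el h]]]]; exists k, l, P; split=> //.
by apply: homN_ext h => s sP; [apply: ea|apply: eb];
  [exact: (cmap_div ek).1|exact: (cmap_div el).1].
Qed.

Definition catN M (a b : nat -> X) : nat -> X :=
  fun t => if t <= M then a t else b (t - M.+1).

Lemma catN_loop M N a b : isloopN M a -> isloopN N b ->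
  isloopN (M + N + 1) (catN M a b).
Proof.
move=> [ca a0 aM] [cb b0 bN]; rewrite /catN; split=> //; last first.
  by rewrite ifF -?bN; [congr b|]; lia.
move=> s s' sL s'L; rewrite /close => ss.
case: leqP => h1; case: leqP => h2.
- by apply: ca.
- have -> : s = M by lia.
  have -> : s' - M.+1 = 0 by lia.
  by rewrite aM b0; exact: adjxx.
- have -> : s' = M by lia.
  have -> : s - M.+1 = 0 by lia.
  by rewrite aM b0; exact: adjxx.
- by apply: cb; rewrite ?/close; lia.
Qed.

Lemma catN_hom M N a b a' b' : homN M a a' -> homN N b b' ->
  homN (M + N + 1) (catN M a b) (catN M a' b').
Proof.
move=> [R [H [h1 h2 h3]]] [R' [H' [h1' h2' h3']]].
exists (R + R'), (fun s t => if s <= M then H s (minn t R)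
                             else H' (s - M.+1) (minn t R')); split.
- move=> s s' t t' sL s'L tR t'R; rewrite /close => ss tt.
  have [m1 m2 m3 m4] := And4 (geq_minr t R) (geq_minr t' R) (geq_minr t R')
    (geq_minr t' R').
  case: leqP => g1; case: leqP => g2.
  + by apply: h1; rewrite ?/close //; lia.
  + have -> : s = M by lia.
    have -> : s' - M.+1 = 0 by lia.
    by rewrite (h3 _ m1).2 (h3' _ m4).1; exact: adjxx.
  + have -> : s' = M by lia.
    have -> : s - M.+1 = 0 by lia.
    by rewrite (h3 _ m2).2 (h3' _ m3).1; exact: adjxx.
  + by apply: h1'; rewrite ?/close //; lia.
- move=> s sL; rewrite /catN !min0n; case: leqP => g1.
    by rewrite (minn_idPr _) ?leq_addr //; exact: h2.
  by rewrite (minn_idPr _) ?leq_addl //; apply: h2'; lia.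
- move=> t tR; rewrite leq0n (h3 _ (geq_minr _ _)).1; split=> //.
  rewrite ifF; last by lia.
  have -> : M + N + 1 - M.+1 = N by lia.
  by rewrite (h3' _ (geq_minr _ _)).2.
Qed.

Lemma catN_sub M N M' N' a b a' b' :
  isloopN M a -> isloopN N b -> isloopN M' a' -> isloopN N' b' ->
  subN M M' a a' -> subN N N' b b' ->
  subN (M + N + 1) (M' + N' + 1) (catN M a b) (catN M' a' b').
Proof.
move=> la lb la' lb' [k [l [P [ek el h]]]] [k' [l' [P' [ek' el' h']]]].
have rescale U V u v p q : P.+1 = p * U.+1 -> P'.+1 = q * V.+1 ->
    isloopN U u -> isloopN V v ->
    subN (P + P' + 1) (U + V + 1)
      (catN P (fun i => u (i %/ p)) (fun i => v (i %/ q))) (catN U u v).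
  move=> ep eq lu lv.
  pose f s := if s <= P then s %/ p else (s - P.+1) %/ q + U.+1.
  have [p1 p2] := cmap_div ep; have [q1 q2] := cmap_div eq.
  have f0 : f 0 = 0 by rewrite /f div0n.
  have fL : f (P + P' + 1) = U + V + 1.
    rewrite /f ifF; last by lia.
    have -> : P + P' + 1 - P.+1 = P' by lia.
    by rewrite (div_max eq); lia.
  have cf : cmap (P + P' + 1) (U + V + 1) f.
    split=> [s sL|s s' sL s'L].
      rewrite /f; case: (leqP s P) => g; first by have := p1 _ g; lia.
      suff : (s - P.+1) %/ q <= V by lia.
      by apply: q1; lia.
    rewrite /f /close => ss; case: (leqP s P) => g1; case: (leqP s' P) => g2.
    - exact: p2.
    - have -> : s = P by lia.
      have -> : s' - P.+1 = 0 by lia.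
      by rewrite (div_max ep) div0n; lia.
    - have -> : s' = P by lia.
      have -> : s - P.+1 = 0 by lia.
      by rewrite (div_max ep) div0n; lia.
    - have := q2 (s - P.+1) (s' - P.+1); rewrite /close => /(_ _ _ _)/andP[].
      + lia.
      + lia.
      + lia.
      + lia.
  have := subN_reparam_end (catN_loop lu lv) cf f0 fL.
  apply: subN_ext => // s sL; rewrite /= /catN /f.
  case: (leqP s P) => g; first by rewrite p1.
  by rewrite addnS ltnNge leq_addl /= -addnS addnK.
apply: subN_trans (rescale _ _ _ _ _ _ el el' la' lb').
apply: subN_trans (subN_sym (rescale _ _ _ _ _ _ ek ek' la lb)) _.
exists 1, 1, (P + P' + 1); rewrite mul1n; split=> //.
by have := catN_hom h h'; apply: homN_ext => s _; rewrite divn1.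
Qed.

Lemma nat_of_concat M N (a : 'I_M.+1 -> X) (b : 'I_N.+1 -> X) s :
  s <= M + N + 1 ->
  nat_of (concat_fun a b) s = catN M (nat_of a) (nat_of b) s.
Proof. by move=> sL; rewrite /nat_of /concat_fun /catN inordK. Qed.

Lemma isloopN_ext M a b : (forall s, s <= M -> a s = b s) ->
  isloopN M a -> isloopN M b.
Proof.
move=> e [h1 h2 h3]; rewrite /isloopN -!e //; split=> // s s' sM s'M.
by rewrite -!e //; exact: h1.
Qed.

Fact concat_loopP (a b : based_loop) : is_based_loop (concat_fun a b).
Proof.
apply/isloopNP; have := catN_loop (loopN a) (loopN b).
by apply: isloopN_ext => s sL; rewrite nat_of_concat.
Qed.

Fact reverse_loopP (a : based_loop) : is_based_loop (reverse_fun a).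
Proof.
have [h1 h2 h3] := loopP a; split.
- move=> s s'; rewrite interval_adjE /close => ss; apply: h1.
  by rewrite interval_adjE /close /=; lia.
- by rewrite -[RHS]h3; congr (a _); apply: val_inj => /=; lia.
- by rewrite -[RHS]h2; congr (a _); apply: val_inj => /=; lia.
Qed.

Fact const_loopP (N : nat) : is_based_loop (fun _ : 'I_N.+1 => x0).
Proof. by split=> // s s' _; exact: adjxx. Qed.

Definition concat_loop (a b : based_loop) := BasedLoop (concat_loopP a b).
Definition reverse_loop (a : based_loop) := BasedLoop (reverse_loopP a).
Definition const_loop (N : nat) := BasedLoop (const_loopP N).

Definition subdiv_rel : rel based_loop :=
  fun a b => `[< subdivision_homotopic a b >].

Fact subdiv_refl : reflexive subdiv_rel.
Proof. by move=> a; apply/asboolP/subNP/subN_refl/loopN. Qed.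

Fact subdiv_sym : symmetric subdiv_rel.
Proof.
by move=> a b; apply/idP/idP => /asboolP/subNP/subN_sym h; apply/asboolP/subNP.
Qed.

Fact subdiv_trans : transitive subdiv_rel.
Proof.
move=> b a c /asboolP/subNP h /asboolP/subNP h'.
by apply/asboolP/subNP; exact: subN_trans h h'.
Qed.

Canonical subdiv_equiv := EquivRel subdiv_rel subdiv_refl subdiv_sym subdiv_trans.

Definition pi1 : Type := {eq_quot subdiv_equiv}.
HB.instance Definition _ := Choice.on pi1.

Definition loop_class (a : based_loop) : pi1 := \pi_({eq_quot subdiv_equiv}) a.

Lemma loop_classP (a b : based_loop) :
  loop_class a = loop_class b <-> subdivision_homotopic a b.
Proof.
by split=> [/eqmodP/asboolP|h] //; apply/eqmodP/asboolP.
Qed.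

Lemma loop_class_surj (u : pi1) : exists a, u = loop_class a.
Proof. by exists (repr u); rewrite /loop_class reprK. Qed.

Definition pi1_mul (u v : pi1) : pi1 := loop_class (concat_loop (repr u) (repr v)).
Definition pi1_one : pi1 := loop_class (const_loop 0).
Definition pi1_inv (u : pi1) : pi1 := loop_class (reverse_loop (repr u)).

Lemma class_subN (a b : based_loop) : loop_class a = loop_class b <->
  subN (loop_len a) (loop_len b) (nat_of a) (nat_of b).
Proof. by rewrite loop_classP; exact: subNP. Qed.

Lemma class_repr (u : pi1) : loop_class (repr u) = u.
Proof. exact: reprK. Qed.

Lemma pi1_mulE (a b : based_loop) :
  pi1_mul (loop_class a) (loop_class b) = loop_class (concat_loop a b).
Proof.
apply/class_subN => /=; set a' := repr _; set b' := repr _.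
have ha : loop_class a' = loop_class a by exact: class_repr.
have hb : loop_class b' = loop_class b by exact: class_repr.
have := catN_sub (loopN a') (loopN b') (loopN a) (loopN b)
  ((class_subN _ _).1 ha) ((class_subN _ _).1 hb).
by apply: subN_ext => s sL; rewrite nat_of_concat.
Qed.

Lemma pi1_oneE (N : nat) : loop_class (const_loop N) = pi1_one.
Proof.
apply/class_subN => /=; apply: (@subN_reparam_end 0 N (fun _ => x0) (fun _ => 0)) => //.
by split=> // s s' _ _ _; exact: adjxx.
Qed.

Definition invN (M : nat) (a : nat -> X) : nat -> X := fun s => a (M - s).

Lemma nat_of_rev M (a : 'I_M.+1 -> X) s : s <= M ->
  nat_of (reverse_fun a) s = invN M (nat_of a) s.
Proof.
move=> sM; rewrite /nat_of /reverse_fun /invN; congr (a _); apply: val_inj => /=.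
by rewrite !inordK // ?subSS // ltnS leq_subr.
Qed.

Lemma pi1_invE (a : based_loop) :
  pi1_inv (loop_class a) = loop_class (reverse_loop a).
Proof.
apply/class_subN => /=; set b := repr _.
have : loop_class b = loop_class a by exact: class_repr.
move=> /class_subN[k [l [P [ek el [R [H [h1 h2 h3]]]]]]].
exists k, l, P; split=> //; exists R, (fun s t => H (P - s) t).
have flip p M s : P.+1 = p * M.+1 -> s <= P -> (P - s) %/ p = M - s %/ p.
  move=> e sP; have p0 : 0 < p by case: p e.
  have -> : P - s = (M - s %/ p) * p + (p.-1 - s %% p).
    have := (cmap_div e).1 _ sP => le.
    have := divn_eq s p; have := ltn_mod s p; rewrite p0 mulnBl.
    have : s %/ p * p <= M * p by rewrite leq_mul2r le orbT.
    move: e; rewrite mulnS (mulnC p M).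
    set x := _ * p; set y := s %/ p * p; set z := s %% p; lia.
  by rewrite divnMDl // [X in _ + X]divn_small ?addn0 //; lia.
split.
- move=> s s' t t' sP s'P tR t'R ss tt.
  by move: ss; rewrite /close => ss; apply: h1 => //; rewrite ?/close; lia.
- move=> s sP; have [-> ->] := h2 (P - s) (leq_subr _ _).
  rewrite (flip _ _ _ ek) // (flip _ _ _ el) // !nat_of_rev //.
    exact: (cmap_div el).1.
  exact: (cmap_div ek).1.
- by move=> t tR; rewrite subn0 subnn; have [] := h3 t tR.
Qed.

Fact pi1_mulA : associative pi1_mul.
Proof.
move=> u v w; have [a ->] := loop_class_surj u.
have [b ->] := loop_class_surj v; have [c ->] := loop_class_surj w.
rewrite !pi1_mulE; apply/class_subN => /=.
set M := loop_len a; set N := loop_len b; set Q := loop_len c.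
have e : M + N + 1 + Q + 1 = M + (N + Q + 1) + 1 by lia.
rewrite [X in subN _ X _ _]e; have := subN_refl (loopN (concat_loop a (concat_loop b c))).
apply: subN_ext => //= s sL.
rewrite (nat_of_concat _ _ sL) nat_of_concat -/M -/N -/Q; last by rewrite e.
rewrite /catN; case: (leqP s M) => g1.
  rewrite ifT; last by lia.
  by rewrite nat_of_concat -/M -/N ?/catN ?g1 //; lia.
rewrite nat_of_concat -/N -/Q ?/catN; last by lia.
case: (leqP s (M + N + 1)) => g2.
  rewrite ifT; last by lia.
  by rewrite nat_of_concat -/M -/N ?/catN 1?ifF //; lia.
rewrite ifF; last by lia.
by congr (nat_of _ _); lia.
Qed.

Fact pi1_mul1 : right_id pi1_one pi1_mul.
Proof.
move=> u; have [a ->] := loop_class_surj u.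
rewrite pi1_mulE; apply/class_subN => /=; set M := loop_len a.
have la := loopN a.
have cf : cmap (M + 0 + 1) M (fun s => minn s M).
  by split=> [s _|s s' _ _]; rewrite ?geq_minr // /close; lia.
have := subN_reparam_end la cf (min0n _).
rewrite (minn_idPr _); last by lia.
move=> /(_ erefl); apply: subN_ext => // s sL.
rewrite nat_of_concat // /catN /=; case: leqP => // g.
by case: la => _ _ ->.
Qed.

Fact pi1_1mul : left_id pi1_one pi1_mul.
Proof.
move=> u; have [a ->] := loop_class_surj u.
rewrite pi1_mulE; apply/class_subN => /=; set M := loop_len a.
have la := loopN a.
have cf : cmap (0 + M + 1) M (fun s => s.-1).
  by split=> [s|s s' _ _]; rewrite ?/close; lia.
have := subN_reparam_end la cf erefl.
rewrite (_ : (0 + M + 1).-1 = M); last by lia.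
move=> /(_ erefl); apply: subN_ext => // s sL.
rewrite nat_of_concat // /catN /=; case: leqP => g.
  by rewrite (_ : s.-1 = 0); [case: la => _ -> _|lia].
by rewrite subn1.
Qed.

(* The loop a followed by its reverse is a reparametrization of a by an
   up-and-down map of intervals, hence contractible. *)
Lemma catN_inv M a : isloopN M a -> subN (M + M + 1) 0 (catN M a (invN M a)) (fun _ => x0).
Proof.
move=> la; pose f s := if s <= M then s else (M + M + 1) - s.
have cf : cmap (M + M + 1) M f.
  split=> [s|s s']; rewrite /f; first by case: (leqP s M); lia.
  by rewrite /close; case: (leqP s M); case: (leqP s' M); lia.
have cg : cmap (M + M + 1) M (fun _ => 0) by split.
have fL : f (M + M + 1) = 0 by rewrite /f; case: (leqP (M + M + 1) M); lia.
have [_ a0 _] := la.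
have := subN_reparam la cf cg erefl fL a0; rewrite fL => /(_ a0) h.
have h' : subN (M + M + 1) (M + M + 1) (catN M a (invN M a)) (fun _ => x0).
  apply: subN_ext h => // s sL; rewrite /= /f /catN /invN.
  by case: leqP => // g; congr (a _); lia.
apply: subN_trans h' _.
apply: (@subN_reparam_end 0 _ (fun _ => x0) (fun _ => 0)) => //.
by split=> // s s' _ _ _; exact: adjxx.
Qed.

Fact pi1_mulV : right_inverse pi1_one pi1_inv pi1_mul.
Proof.
move=> u; have [a ->] := loop_class_surj u.
rewrite pi1_invE pi1_mulE; apply/class_subN => /=.
have := catN_inv (loopN a); apply: subN_ext => // s sL.
rewrite nat_of_concat // /catN; case: leqP => // g.
by rewrite nat_of_rev //; lia.
Qed.

Fact pi1_Vmul : left_inverse pi1_one pi1_inv pi1_mul.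
Proof.
move=> u; have [a ->] := loop_class_surj u.
rewrite pi1_invE pi1_mulE; apply/class_subN => /=.
have lr : isloopN (loop_len a) (nat_of (reverse_fun a)).
  exact: (loopN (reverse_loop a)).
have := catN_inv lr; apply: subN_ext => // s sL.
rewrite nat_of_concat // /catN; case: leqP => // g.
rewrite /invN nat_of_rev ?leq_subr // /invN; congr (nat_of _ _); lia.
Qed.

HB.instance Definition _ := isGroup.Build pi1
  pi1_mulA pi1_1mul pi1_mul1 pi1_Vmul pi1_mulV.

Lemma pi1_mulgE (u v : pi1) : (u * v)%g = pi1_mul u v.
Proof. by []. Qed.

End Loops.

Definition free_on (G : groupType) (I : Type) (b : I -> G) : Prop :=
  forall (H : groupType) (f : I -> H),
    (exists phi : UMagmaMorphism.type G H, forall i, phi (b i) = f i) /\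
    (forall phi psi : UMagmaMorphism.type G H,
       (forall i, phi (b i) = f i) -> (forall i, psi (b i) = f i) -> phi =1 psi).

Definition is_free_group (G : groupType) : Prop :=
  exists (I : Type) (b : I -> G), free_on b.

(* Main.v *)
From HB Require Import structures.
Require Import Defs.
From mathcomp Require Import all_boot all_order all_algebra finmap.
From mathcomp Require Import boolp zify.

Set Implicit Arguments.
Unset Strict Implicit.
Unset Printing Implicit Defensive.

(** A loop in a digital image X is a closed walk in the adjacency graph, and
    homotopies only slide walks across cliques.  So homomorphisms from the
    fundamental group to a group G are governed by cocycles: functions c on
    adjacent pairs with c x y * c y z = c x z on cliques.  Multiplying the values
    of a cocycle along a loop gives its holonomy, which is a homomorphism
    (lemma pi1_holonomy_morph).

    The heart of the proof is combinatorial.  Sweep the plane in the order of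
    increasing 2 x + y.  When a point v is reached, its earlier neighbours lie
    among A = v + (0,-1), B = v + (-1,-1), C = v + (-1,0) and D = v + (-1,1).
    If C belongs to X, it is adjacent to all the others; if not, A and B are
    adjacent to each other but not to D.  In all cases each connected component
    of the set of earlier neighbours of v is a cone, that is, contains a vertex
    adjacent to all its vertices.  Call the edges from v to these apices the
    skeleton.  Up to homotopy, attaching v along a cone amounts to adding the
    single edge from v to its apex; hence the fundamental group of X is that of the
    skeleton, a graph, and the fundamental group of a graph is free.

    In terms of cocycles, with no topology: arbitrary values on the skeleton
    extend to a cocycle (skeleton_cocycle), and a cocycle is determined by its
    values on the skeleton (cocycle_uniq), because c v w = c v a * c a w for an
    earlier neighbour w of v in the cone with apex a, and the edge from a to w
    was treated before.  The same induction shows that the skeleton is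
    connected.

    Choose a spanning tree of the skeleton.  To each edge (x, y) of X belongs the
    loop that follows the tree to x, crosses the edge and returns along the tree.
    The classes of these loops form a cocycle with values in the fundamental
    group itself, trivial on the tree, and every loop is its own holonomy for it
    (holonomy_tree_cocycle).  The classes that belong to the skeleton edges
    outside the tree form a basis.  A homomorphism with prescribed values on it
    is the holonomy of the cocycle with these values there and 1 on the tree.
    It is unique because two homomorphisms that agree on the basis turn the
    cocycle of loops into two cocycles that agree on the skeleton. *)

(** * Cocycles on the cliques of a graph *)

Section Cocycles.
Context (T : Type) (e : rel T).
Hypotheses (exx : reflexive e) (eC : symmetric e).

Definition cocycle (G : groupType) (c : T -> T -> G) : Prop :=
  forall x y z, e x y -> e y z -> e x z -> (c x y * c y z = c x z)%g.

Lemma cocycle1 (G : groupType) (c : T -> T -> G) x : cocycle c -> (c x x = 1)%g.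
Proof. by move=> cc; apply: (mulgI (c x x)); rewrite cc // mulg1. Qed.

Lemma cocycleV (G : groupType) (c : T -> T -> G) x y :
  cocycle c -> e x y -> (c y x = (c x y)^-1)%g.
Proof.
move=> cc xy; have yx : e y x by rewrite eC.
by apply/esym/mulg1_eq; rewrite (cc x y x) // cocycle1.
Qed.

End Cocycles.

(** * Elimination orderings whose earlier neighbourhoods are unions of cones *)

Section ConeElimination.
Context (T : eqType) (e : rel T) (rank : T -> nat) (apex : T -> T -> T).
Hypotheses (exx : reflexive e) (eC : symmetric e).

Definition earlier v w := e v w && (rank w < rank v).

(** As [apex v] identifies adjacent earlier neighbours of [v], it is constant on
    each connected component of their set; as [apex v w] is itself an earlier
    neighbour adjacent to [w], each component is a cone.  Distinct vertices of
    the same rank are not adjacent, so all those of one rank can be added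
    at once. *)
Definition cone_elimination : Prop :=
  [/\ forall v w, e v w -> rank v = rank w -> v = w,
      forall v w, earlier v w -> earlier v (apex v w) /\ e w (apex v w)
    & forall v w w', earlier v w -> earlier v w' -> e w w' ->
        apex v w = apex v w'].

Definition skeleton v w := earlier v w && (apex v w == w).

Hypothesis elim : cone_elimination.

Lemma skeleton_apex v w : earlier v w -> skeleton v (apex v w).
Proof.
have [_ h2 h3] := elim => vw; have [va wa] := h2 _ _ vw.
by rewrite /skeleton va; apply/eqP/esym/h3.
Qed.

(** Every edge is reached from the skeleton through cliques: an edge from [v] to
    an earlier [w] completes the triangle on [v], [apex v w] and [w], whose
    other edges are a skeleton edge and an edge with both ends earlier than
    [v]. *)
Lemma skeleton_ind (P : T -> T -> Prop) :
    (forall x, P x x) -> (forall x y, P x y -> P y x) ->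
    (forall x y z, e x y -> e y z -> e x z -> P x y -> P y z -> P x z) ->
    (forall v w, skeleton v w -> P v w) ->
  forall x y, e x y -> P x y.
Proof.
move=> P1 PC PM Psk x y; have [n] := ubnP (maxn (rank x) (rank y)).
elim: n => // n IH in x y *.
wlog lt_yx : x y / rank y < rank x.
  move=> W len exy; case: (ltngtP (rank x) (rank y)) => [lt|lt|eq].
  - by apply/PC/W; rewrite // 1?eC // maxnC.
  - exact: W.
  - by have [h _ _] := elim; rewrite (h _ _ exy eq).
move=> len exy; have xy : earlier x y by rewrite /earlier exy.
have sk := skeleton_apex xy; have [_ h2 _] := elim.
have [/andP[xa lt_ax] ya] := h2 _ _ xy; have ay : e (apex x y) y by rewrite eC.
apply: (PM _ (apex x y)) => //; first exact: Psk.
by apply: IH => //; lia.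
Qed.

Lemma cocycle_uniq (G : groupType) (c d : T -> T -> G) :
    cocycle e c -> cocycle e d -> (forall v w, skeleton v w -> c v w = d v w) ->
  forall x y, e x y -> c x y = d x y.
Proof.
move=> cc cd sk x y exy.
suff [//] : (c x y = d x y) /\ (c y x = d y x).
elim/skeleton_ind: x y / exy => [x|x y|x y z xy yz xz [hxy hyx] [hyz hzy]|v w vw].
- by rewrite !(cocycle1 exx).
- by case.
- by rewrite -(cc x y) // -(cd x y) // -(cc z y) ?(eC z) // ?(eC y x) //
     -(cd z y) ?(eC z) // ?(eC y x) // hxy hyx hyz hzy.
- rewrite sk //; split=> //; move: (vw) => /andP[/andP[evw _] _].
  by rewrite (cocycleV exx eC cc evw) (cocycleV exx eC cd evw) sk.
Qed.

(** The values on an edge from a new vertex [v] are forced by those on earlier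
    edges and on the skeleton.  They satisfy the cocycle condition on a triangle
    [v], [y], [z] because [y] and [z] have the same apex [a], so that the
    condition reduces to that on the earlier clique [a], [y], [z]. *)
Lemma cocycle_extend (G : groupType) (g : T -> T -> G) n : exists c : T -> T -> G,
  (forall x y z, rank x < n -> rank y < n -> rank z < n ->
     e x y -> e y z -> e x z -> (c x y * c y z = c x z)%g) /\
  (forall v w, rank v < n -> skeleton v w -> c v w = g v w).
Proof.
have [h1 h2 h3] := elim.
elim: n => [|n [c [cc cg]]]; first by exists g.
(* The value forced on the edge from a vertex v of rank n to w. *)
pose a v w := (g v (apex v w) * c (apex v w) w)%g.
pose c' x y := if rank x < n then if rank y < n then c x y else (a y x)^-1%g
  else if rank y < n then a x y else 1%g.
have aM v y z : rank v = n -> rank y < n -> rank z < n ->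
    e v y -> e v z -> e y z -> (a v y * c y z = a v z)%g.
  move=> vn yn zn vy vz yz.
  have ey : earlier v y by rewrite /earlier vy vn.
  have ez : earlier v z by rewrite /earlier vz vn.
  have eqa : apex v y = apex v z by apply: h3.
  have [/andP[_ ry] ya] := h2 _ _ ey; have [_ za] := h2 _ _ ez.
  rewrite /a -eqa -mulgA; congr (_ * _)%g; apply: cc => //.
  - by rewrite -vn.
  - by rewrite eC.
  - by rewrite eqa eC.
exists c'; split=> [x y z|v w].
  rewrite !ltnS => xn yn zn xy yz xz.
  have yx : e y x by rewrite eC.
  have zy : e z y by rewrite eC.
  have zx : e z x by rewrite eC.
  have top u : rank u <= n -> n <= rank u -> rank u = n.
    by move=> *; apply/eqP; rewrite eqn_leq; apply/andP.
  rewrite /c'; case: (ltnP (rank x)) => xn'; case: (ltnP (rank y)) => yn';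
    case: (ltnP (rank z)) => zn' //.
  - exact: cc.
  - have e1 := aM z x y (top _ zn zn') xn' yn' zx zy xy.
    by rewrite -e1 invgM mulgA mulgV mul1g.
  - have e1 := aM y x z (top _ yn yn') xn' zn' yx yz xz.
    by rewrite -e1 mulKg.
  - by rewrite (h1 y z) ?mulg1 // (top y) // (top z).
  - exact: aM (top _ xn xn') _ _ _ _ _.
  - by rewrite (h1 x z) ?mulgV // (top x) // (top z).
  - by rewrite mul1g (h1 x y) // (top x) // (top y).
  - by rewrite mulg1.
rewrite ltnS => vn sk; move: (sk) => /andP[ew /eqP apw].
have [evw wv] := andP ew.
have wn : rank w < n by exact: leq_trans vn.
rewrite /c' wn; case: ltnP => vn'; first exact: cg.
rewrite /a apw (_ : c w w = 1%g) ?mulg1 //.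
by apply: (mulgI (c w w)); rewrite cc // mulg1.
Qed.

End ConeElimination.

Lemma skeleton_cocycle (T : finType) (e : rel T) (rank : T -> nat)
    (apex : T -> T -> T) (G : groupType) (g : T -> T -> G) :
    reflexive e -> symmetric e -> cone_elimination e rank apex ->
  exists c : T -> T -> G, cocycle e c /\
    (forall v w, skeleton e rank apex v w -> c v w = g v w).
Proof.
move=> exx eC elim; pose n := (\max_(x : T) rank x).+1.
have rn x : rank x < n by rewrite ltnS leq_bigmax.
have [c [cc cg]] := cocycle_extend exx eC elim g n.
by exists c; split=> [x y z|v w]; [exact: cc|exact: cg].
Qed.

(** * Spanning trees *)

(** [p] gives the parent of a vertex other than the root, and [tau x] is the
    branch from the root [x0] to [x], listed without [x0]; the shape of [tau]
    makes [p] well founded. *)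
Definition rooted_tree (T : eqType) (e : rel T) (x0 : T) (p : T -> T)
    (tau : T -> seq T) : Prop :=
  tau x0 = [::] /\
  forall x, x != x0 -> e (p x) x /\ tau x = rcons (tau (p x)) x.

(** A vertex hangs from the last but one vertex of a shortest path from the
    root. *)
Lemma spanning_tree (T : finType) (e : rel T) (x0 : T) :
    (forall x, connect e x0 x) ->
  exists (p : T -> T) (tau : T -> seq T), rooted_tree e x0 p tau.
Proof.
move=> conn.
have ex x : exists n, `[< exists2 s, path e x0 s & x = last x0 s /\ size s = n >].
  have /connectP[s ps ls] := conn x.
  by exists (size s); apply/asboolP; exists s.
pose d x := ex_minn (ex x).
have dP x : exists2 s, path e x0 s & x = last x0 s /\ size s = d x.
  by rewrite /d; case: ex_minnP => m /asboolP.
have d_min s : path e x0 s -> d (last x0 s) <= size s.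
  by move=> ps; rewrite /d; case: ex_minnP => m _; apply; apply/asboolP; exists s.
have step x : exists y, x != x0 -> e y x /\ d x = (d y).+1.
  have [s ps [-> sd]] := dP x; case/lastP: s ps sd => [|s y].
    by move=> _ _; exists x0; rewrite eqxx.
  rewrite last_rcons rcons_path size_rcons => /andP[ps ey] sd.
  exists (last x0 s) => _; split=> //; apply/eqP; rewrite eqn_leq -{1}sd ltnS.
  have := d_min _ ps; have [t pt [lt td]] := dP (last x0 s).
  have := d_min (rcons t y); rewrite last_rcons rcons_path size_rcons -lt pt ey.
  by move=> /(_ isT); rewrite td; lia.
have [p pP] := choice step.
pose fix branch n x {struct n} := if n is m.+1 then rcons (branch m (p x)) x else [::].
exists p, (fun x => branch (d x) x); split.
  by have := d_min [::] isT; rewrite /= leqn0 => /eqP ->.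
by move=> x xx0; have [epx ->] := pP x xx0.
Qed.

Section RootedTree.
Context (T : eqType) (e : rel T) (x0 : T) (p : T -> T) (tau : T -> seq T).
Hypothesis tree : rooted_tree e x0 p tau.

Lemma tree_ind (P : T -> Prop) :
  P x0 -> (forall x, x != x0 -> P (p x) -> P x) -> forall x, P x.
Proof.
move=> P0 PS x; have [_ tr] := tree.
have [n] := ubnP (size (tau x)); elim: n => // n IH in x *.
have [->//|xx0] := eqVneq x x0; have [_ ->] := tr x xx0.
by rewrite size_rcons !ltnS => lt; apply: PS => //; apply: IH.
Qed.

Lemma last_branch x : last x0 (tau x) = x.
Proof.
have [t0 tr] := tree; have [->|/tr[_ ->]] := eqVneq x x0; first by rewrite t0.
by rewrite last_rcons.
Qed.

Lemma branch_path x : path e x0 (tau x).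
Proof.
have [t0 tr] := tree; elim/tree_ind: x => [|x /tr[epx ->] IH]; first by rewrite t0.
by rewrite rcons_path IH last_branch.
Qed.

(** The way back from [x] to the root, listed without [x]. *)
Definition descent x := rev (belast x0 (tau x)).

Lemma descent_root : descent x0 = [::].
Proof. by rewrite /descent tree.1. Qed.

Lemma descentS x : x != x0 -> descent x = p x :: descent (p x).
Proof.
move=> /tree.2[_ tx]; rewrite /descent tx belast_rcons.
by rewrite lastI last_branch rev_rcons.
Qed.

Lemma last_descent x : last x (descent x) = x0.
Proof.
by elim/tree_ind: x => [|x xx0 IH]; [rewrite descent_root|rewrite descentS].
Qed.

Lemma descent_path x : symmetric e -> path e x (descent x).
Proof.
move=> eC; elim/tree_ind: x => [|x xx0 IH]; first by rewrite descent_root.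
by rewrite descentS //= IH eC (tree.2 x xx0).1.
Qed.

End RootedTree.

(** * Loops as closed walks *)

Lemma image_adj_sym n (X : {fset 'rV[int]_n}) : symmetric (@image_adj n X).
Proof. by move=> x y; apply/idP/idP => /adjC. Qed.

Section Walks.
Context (n : nat) (X : {fset 'rV[int]_n}) (x0 : X).
Local Notation e := (@image_adj n X).

Let exx : reflexive e := @adjxx n X.
Let eC : symmetric e := @image_adj_sym n X.

(** A closed walk at [x0] is listed without its starting point, so that
    concatenation of lists is composition of walks; the loop of [s] is
    [nth x0 (x0 :: s)], of length [size s]. *)
Definition closed_walk (s : seq X) := path e x0 s && (last x0 s == x0).

Lemma closed_walk_isloopN s :
  closed_walk s -> isloopN x0 (size s) (nth x0 (x0 :: s)).
Proof.
move=> /andP[/(pathP x0) es /eqP ls]; split=> //; last by rewrite -[RHS]ls (last_nth x0).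
have step i : i < size s -> e (nth x0 (x0 :: s) i) (nth x0 (x0 :: s) i.+1) by exact: es.
move=> i j li lj /andP[ij ji]; case: (ltngtP i j) => [lt|lt|->]; last exact: exx.
  by have -> : j = i.+1 by [lia]; apply: step; lia.
by have -> : i = j.+1 by [lia]; rewrite /adj -/e eC; apply: step; lia.
Qed.

Definition walk_fun (s : seq X) (i : 'I_(size s).+1) : X := nth x0 (x0 :: s) i.

Lemma nat_of_walk s i : i <= size s -> nat_of (@walk_fun s) i = nth x0 (x0 :: s) i.
Proof. by move=> le; rewrite /nat_of /walk_fun inordK. Qed.

Lemma walk_loopP s : closed_walk s -> is_based_loop x0 (@walk_fun s).
Proof.
move=> /closed_walk_isloopN ls; apply/isloopNP.
by apply: isloopN_ext ls => i le; rewrite nat_of_walk.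
Qed.

Definition walk_class (s : seq X) : pi1 x0 :=
  if boolP (closed_walk s) is AltTrue cs then loop_class (BasedLoop (walk_loopP cs))
  else pi1_one x0.

Lemma walk_classE s (cs : closed_walk s) :
  walk_class s = loop_class (BasedLoop (walk_loopP cs)).
Proof.
rewrite /walk_class; case: {-}_ / boolP => [cs'|]; last by rewrite cs.
by rewrite (bool_irrelevance cs cs').
Qed.

Lemma walk_class_subN s t : closed_walk s -> closed_walk t ->
    subN x0 (size s) (size t) (nth x0 (x0 :: s)) (nth x0 (x0 :: t)) ->
  walk_class s = walk_class t.
Proof.
move=> cs ct; rewrite !walk_classE => h; apply/class_subN => /=.
by apply: subN_ext h => i le; rewrite nat_of_walk.
Qed.

Lemma walk_class_surj (u : pi1 x0) : exists2 s, closed_walk s & u = walk_class s.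
Proof.
have [a ->] := loop_class_surj u; have [ca a0 aM] := loopN a.
set M := loop_len a in ca aM; pose b := nat_of a.
pose s := [seq b i.+1 | i <- iota 0 M].
have sz : size s = M by rewrite size_map size_iota.
have nths i : i <= M -> nth x0 (x0 :: s) i = b i.
  by case: i => [|i] le //=; rewrite (nth_map 0) ?size_iota // nth_iota.
have cs : closed_walk s.
  apply/andP; split; last by rewrite (last_nth x0) sz nths // /b aM.
  apply/(pathP x0) => i; rewrite sz => lt; rewrite nths 1?ltnW //.
  by rewrite -[nth _ s i]/(nth x0 (x0 :: s) i.+1) nths //; apply: ca; rewrite /close; lia.
exists s => //; rewrite (walk_classE cs); apply/class_subN => /=.
have := subN_refl (loopN a); rewrite -/M -[X in subN _ _ X]sz.
apply: subN_ext => i le //; rewrite nat_of_walk //; rewrite sz in le.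
by rewrite nths.
Qed.

(** Pausing at a vertex is a reparametrization of the loop. *)
Lemma walk_stutter p q : closed_walk (p ++ q) ->
  walk_class (p ++ last x0 p :: q) = walk_class (p ++ q).
Proof.
move=> cpq; have cppq : closed_walk (p ++ last x0 p :: q).
  by move: cpq; rewrite /closed_walk !cat_path !last_cat /= exx.
apply: walk_class_subN => //.
pose f i := if i <= size p then i else i.-1.
have := @subN_reparam_end n X x0 (size (p ++ q)) (size (p ++ last x0 p :: q)) _ f
   (closed_walk_isloopN cpq).
rewrite !size_cat /= => h; apply: subN_ext (h _ _ _) => //.
- move=> i le /=; rewrite /f -!cat_cons !nth_cat /=.
  case: (ltngtP i (size p)) => [lt|gt|->].
  + by rewrite ltnS (ltnW lt).
  + have -> : i < (size p).+1 = false by lia.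
    case: i gt le => // i; rewrite !ltnS subSS /= => gt le.
    case: (ltngtP i (size p)) gt => // [lt _|-> _].
      by have -> : i - size p = (i - (size p).+1).+1 by lia.
    by rewrite subnn /= -last_nth.
  + by rewrite ltnSn.
- split=> [i|i j]; rewrite /f /close; first by case: (leqP i (size p)); lia.
  by case: (leqP i (size p)); case: (leqP j (size p)); lia.
- by rewrite /f ifF; lia.
Qed.

Lemma homN_move M (a b : nat -> X) k : isloopN x0 M a -> isloopN x0 M b ->
    (forall i, i <= M -> i != k -> a i = b i) -> e (a k) (b k) ->
  homN x0 M a b.
Proof.
move=> [ca a0 aM] [cb b0 bM] ab abk.
have step i j : i <= M -> j <= M -> close i j -> e (a i) (b j).
  move=> iM jM ij; have [ik|ik] := eqVneq i k; last by rewrite ab //; exact: cb.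
  have [jk|jk] := eqVneq j k; first by rewrite ik jk.
  by rewrite -ab //; exact: ca.
exists 1, (fun i t => if t is 0 then a i else b i); split=> //; last by case.
move=> i j [|t] [|t'] iM jM _ _ ij _; [exact: ca|exact: step| |exact: cb].
by apply: adjC; apply: step => //; move: ij; rewrite /close andbC.
Qed.

Lemma walk_slide p q x y z : e x y -> closed_walk (p ++ x :: z :: q) ->
  closed_walk (p ++ y :: z :: q) ->
  walk_class (p ++ x :: z :: q) = walk_class (p ++ y :: z :: q).
Proof.
move=> xy cx cy; apply: walk_class_subN => //.
(* The loop starts with x0, which p omits: hence the successor. *)
have := homN_move (k := (size p).+1) (closed_walk_isloopN cx).
move=> /(_ (nth x0 (x0 :: p ++ y :: z :: q))) h.
exists 1, 1, (size (p ++ x :: z :: q)); rewrite !size_cat /= !mul1n; split=> //.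
rewrite !size_cat /= in h; apply: homN_ext (h _ _ _) => [i le|i le||[|i] le ik|] //=.
- by rewrite divn1.
- by rewrite divn1.
- by have := closed_walk_isloopN cy; rewrite size_cat.
- rewrite !nth_cat; case: ltnP => // ge.
  by have -> : i - size p = (i - size p).-1.+1 by rewrite eqSS in ik; lia.
- by rewrite !nth_cat ltnn subnn.
Qed.

(** Replacing the two steps [x], [y], [z] in a clique by one step from [x] to [z]
    shortens the walk, while homotopies preserve length: so first pause at [x],
    then move the repeated [x] to [y]. *)
Lemma walk_shortcut p q y z : e (last x0 p) y -> e y z -> e (last x0 p) z ->
    closed_walk (p ++ z :: q) ->
  walk_class (p ++ y :: z :: q) = walk_class (p ++ z :: q).
Proof.
move=> xy yz xz cw; rewrite -(walk_stutter cw).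
move: cw; rewrite /closed_walk cat_path last_cat /= => /andP[/and3P[pp _ pq] lq].
by apply: walk_slide; rewrite 1?eC // /closed_walk cat_path last_cat /=
  pp ?exx ?xy ?yz ?xz pq.
Qed.

(** In the group law the loops are joined by a step from [x0] to itself, which
    does not occur in [s ++ t]. *)
Lemma walk_class_cat s t : closed_walk s -> closed_walk t ->
  walk_class (s ++ t) = (walk_class s * walk_class t)%g.
Proof.
move=> cs ct; have [/andP[ps /eqP ls] /andP[pt lt]] := (cs, ct).
have cst : closed_walk (s ++ t) by rewrite /closed_walk cat_path ps last_cat ls pt.
have cst' : closed_walk (s ++ x0 :: t).
  by rewrite /closed_walk cat_path ps last_cat /= ls exx pt.
rewrite -walk_stutter // ls pi1_mulgE (walk_classE cst') (walk_classE cs) (walk_classE ct).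
rewrite pi1_mulE; apply/class_subN => /=.
have := subN_refl (closed_walk_isloopN cst').
rewrite [X in subN _ _ X](_ : _ = size s + size t + 1); last by rewrite size_cat /=; lia.
apply: subN_ext => i le; first by rewrite nat_of_walk.
rewrite nat_of_concat // /catN -cat_cons nth_cat /= ltnS.
by case: leqP => h; rewrite nat_of_walk //; lia.
Qed.

Lemma walk_class_nil : walk_class [::] = 1%g.
Proof.
have c0 : closed_walk [::] by rewrite /closed_walk /= eqxx.
by apply: (mulgI (walk_class [::])); rewrite -walk_class_cat // mulg1.
Qed.

(** * Holonomy of a cocycle *)

Section Holonomy.
Context (G : groupType) (c : X -> X -> G).
Hypothesis cc : cocycle e c.

Definition holonomy (x : X) (s : seq X) : G := (\prod_(g <- pairmap c x s) g)%g.

Lemma holonomy_cons x y s : holonomy x (y :: s) = (c x y * holonomy y s)%g.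
Proof. by rewrite /holonomy /= big_cons. Qed.

Lemma holonomy_cat x s t :
  holonomy x (s ++ t) = (holonomy x s * holonomy (last x s) t)%g.
Proof. by rewrite /holonomy pairmap_cat big_cat. Qed.

Definition holonomyN (a : nat -> X) (m : nat) : G := (\prod_(i < m) c (a i) (a i.+1))%g.

Lemma holonomyN0 a : holonomyN a 0 = 1%g.
Proof. exact: big_ord0. Qed.

Lemma holonomyNS a m : holonomyN a m.+1 = (holonomyN a m * c (a m) (a m.+1))%g.
Proof. exact: big_ord_recr. Qed.

Lemma holonomyN_ext a b m :
  (forall i, i <= m -> a i = b i) -> holonomyN a m = holonomyN b m.
Proof. by move=> ab; apply: eq_bigr => i _; rewrite !ab // ltnW. Qed.

Lemma holonomyN_nth s : holonomyN (nth x0 (x0 :: s)) (size s) = holonomy x0 s.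
Proof.
rewrite /holonomy (big_nth 1%g) size_pairmap big_mkord.
by apply: eq_bigr => i _; rewrite (nth_pairmap x0).
Qed.

(** Successive rows of a homotopy bound a strip of cliques: pushing the vertical
    edge across the strip moves the holonomy of one row to that of the next,
    and the vertical edges at both ends are constant. *)
Lemma holonomyN_hom M a b : homN x0 M a b -> holonomyN a M = holonomyN b M.
Proof.
move=> [R [H [h1 h2 h3]]].
have sweep t : t < R -> forall m, m <= M ->
   (holonomyN (H^~ t) m * c (H m t) (H m t.+1) =
    c (H 0 t) (H 0 t.+1) * holonomyN (H^~ t.+1) m)%g.
  move=> tR; elim=> [|m IH] mM; first by rewrite !holonomyN0 mul1g mulg1.
  rewrite !holonomyNS mulgA -IH ?(ltnW mM) // -!mulgA; congr (_ * _)%g.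
  by rewrite !cc //; apply: h1; rewrite /close; lia.
have row t : t <= R -> holonomyN (H^~ t) M = holonomyN (H^~ 0) M.
  elim: t => // t IH tR; rewrite -(IH (ltnW tR)).
  have := sweep _ tR _ (leqnn M); rewrite (h3 t (ltnW tR)).1 (h3 t (ltnW tR)).2.
  by rewrite (h3 t.+1 tR).1 (h3 t.+1 tR).2 (cocycle1 exx) // mulg1 mul1g.
transitivity (holonomyN (H^~ 0) M).
  by apply: holonomyN_ext => i iM; rewrite (h2 i iM).1.
by rewrite -(row R) //; apply: holonomyN_ext => i iM; rewrite (h2 i iM).2.
Qed.

(** The subdivided loop at time [m] has crossed the same edges as the loop at
    time [m %/ k], apart from pauses. *)
Lemma holonomyN_div a k m : 0 < k ->
  holonomyN (fun i => a (i %/ k)) m = holonomyN a (m %/ k).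
Proof.
move=> k0; elim: m => [|m IH]; first by rewrite div0n !holonomyN0.
rewrite holonomyNS IH divnS //.
case: (k %| m.+1); rewrite ?add0n ?add1n; first by rewrite holonomyNS.
by rewrite (cocycle1 exx) // mulg1.
Qed.

Lemma holonomyN_sub M N a b : subN x0 M N a b -> holonomyN a M = holonomyN b N.
Proof.
move=> [k [l [P [ek el h]]]].
have [k0 l0] : 0 < k /\ 0 < l by split; [case: k ek {h} | case: l el {h}].
by rewrite -(div_max ek) -(div_max el) -!holonomyN_div //; exact: holonomyN_hom.
Qed.

Definition pi1_holonomy (u : pi1 x0) : G :=
  holonomyN (nat_of (repr u)) (loop_len (repr u)).

Lemma pi1_holonomyE s : closed_walk s -> pi1_holonomy (walk_class s) = holonomy x0 s.
Proof.
move=> cs; rewrite -holonomyN_nth /pi1_holonomy.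
have /class_subN/holonomyN_sub -> : loop_class (repr (walk_class s)) =
    loop_class (BasedLoop (walk_loopP cs)).
  by rewrite class_repr (walk_classE cs).
by apply: holonomyN_ext => i le; rewrite nat_of_walk.
Qed.

Lemma pi1_holonomy_morph : monoid_morphism pi1_holonomy.
Proof.
split.
  by rewrite -walk_class_nil pi1_holonomyE /closed_walk /= ?eqxx // /holonomy big_nil.
move=> u v; have [s cs ->] := walk_class_surj u; have [t ct ->] := walk_class_surj v.
have [/andP[ps /eqP ls] /andP[pt lt]] := (cs, ct).
rewrite -walk_class_cat // !pi1_holonomyE ?holonomy_cat ?ls //.
by rewrite /closed_walk cat_path ps last_cat ls pt.
Qed.

End Holonomy.

End Walks.

(** * The cocycle of loops through a spanning tree *)

Section TreeCocycle.
Context (n : nat) (X : {fset 'rV[int]_n}) (x0 : X).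
Local Notation e := (@image_adj n X).
Context (p : X -> X) (tau : X -> seq X).
Hypothesis tree : rooted_tree e x0 p tau.
Local Notation descent := (descent x0 tau).

Let exx : reflexive e := @adjxx n X.
Let eC : symmetric e := @image_adj_sym n X.

Definition tree_cocycle (x y : X) : pi1 x0 := walk_class x0 (tau x ++ y :: descent y).

Lemma closed_walk_close x w : last x0 w = x -> path e x0 w ->
  closed_walk x0 (w ++ descent x).
Proof.
move=> lw pw; rewrite /closed_walk cat_path pw last_cat lw.
by rewrite (descent_path tree) // (last_descent tree) eqxx.
Qed.

Lemma closed_walk_open w u : closed_walk x0 (w ++ u) ->
  closed_walk x0 (tau (last x0 w) ++ u).
Proof.
rewrite /closed_walk !cat_path !last_cat (last_branch tree) (branch_path tree).
by move=> /andP[/andP[_ ->]].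
Qed.

Lemma closed_walk_edge x y : e x y -> closed_walk x0 (tau x ++ y :: descent y).
Proof.
move=> xy; rewrite -cat_rcons closed_walk_close ?last_rcons //.
by rewrite rcons_path (branch_path tree) (last_branch tree).
Qed.

(** Induction on the branch: once the detour from the parent of [x] to the root
    and back is removed, a step to the parent and back is left, and a shortcut
    turns it into a pause at [x]. *)
Lemma walk_class_cancel x w u : last x0 w = x -> closed_walk x0 (w ++ u) ->
  walk_class x0 (w ++ descent x ++ tau x ++ u) = walk_class x0 (w ++ u).
Proof.
elim/(tree_ind tree): x => [|x xx0 IH] in w u * => lw cw.
  by rewrite (descent_root tree) tree.1.
have [epx tx] := tree.2 x xx0; have exp : e x (p x) by rewrite eC.
move: (cw); rewrite /closed_walk cat_path last_cat lw => /andP[/andP[pw pu] lu].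
have cxw : closed_walk x0 (w ++ x :: u).
  by rewrite /closed_walk cat_path last_cat /= lw pw exx pu.
rewrite (descentS tree) // tx cat_rcons cat_cons -(cat_rcons (p x)) IH ?last_rcons //; last first.
  by rewrite /closed_walk cat_path last_cat rcons_path last_rcons /= lw pw exp epx pu.
by rewrite cat_rcons walk_shortcut ?lw // -[in x :: u]lw walk_stutter.
Qed.

(** A closed walk splits at any of its vertices, by going to the root and back
    along the tree. *)
Lemma walk_class_split w u : closed_walk x0 (w ++ u) ->
  walk_class x0 (w ++ u) =
    (walk_class x0 (w ++ descent (last x0 w)) * walk_class x0 (tau (last x0 w) ++ u))%g.
Proof.
move=> cw; have pw : path e x0 w by move: cw; rewrite /closed_walk cat_path => /andP[/andP[]].
rewrite -walk_class_cat -?catA ?walk_class_cancel //; first exact: closed_walk_close.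
exact: closed_walk_open.
Qed.

Lemma tree_cocycle_split x y u : closed_walk x0 (tau x ++ y :: u) ->
  walk_class x0 (tau x ++ y :: u) = (tree_cocycle x y * walk_class x0 (tau y ++ u))%g.
Proof.
rewrite /tree_cocycle -!(cat_rcons y) => cw.
by rewrite (walk_class_split cw) last_rcons.
Qed.

(** The loops of the edges [x y] and [y z] compose to a walk that takes both
    edges, and the clique allows the shortcut from [x] to [z]. *)
Lemma tree_cocycleP : cocycle e tree_cocycle.
Proof.
move=> x y z xy yz xz; have cxz := closed_walk_edge xz.
rewrite -tree_cocycle_split.
  by apply: walk_shortcut; rewrite ?(last_branch tree).
move: cxz; rewrite /closed_walk !cat_path !last_cat /= (last_branch tree).
by rewrite xy yz xz.
Qed.

(** Going to [x] along the tree and back is an idempotent of the group. *)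
Lemma tree_cocycle_tree x : x != x0 -> tree_cocycle (p x) x = 1%g.
Proof.
move=> xx0; have [_ tx] := tree.2 x xx0; rewrite /tree_cocycle -cat_rcons -tx.
have := closed_walk_close (last_branch tree x) (branch_path tree x) => cx.
have := walk_class_split cx; rewrite (last_branch tree) => ee.
by apply: (mulgI (walk_class x0 (tau x ++ descent x))); rewrite mulg1.
Qed.

(** Every class is thus a product of the values of [tree_cocycle], which
    therefore generate the group. *)
Lemma holonomy_tree_cocycle s :
  closed_walk x0 s -> holonomy tree_cocycle x0 s = walk_class x0 s.
Proof.
suff H x : closed_walk x0 (tau x ++ s) ->
    holonomy tree_cocycle x s = walk_class x0 (tau x ++ s).
  by move=> cs; rewrite H tree.1.
elim: s => [|y s IH] in x * => cs.
  move: cs; rewrite /closed_walk cats0 (last_branch tree) => /andP[_ /eqP ->].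
  by rewrite tree.1 walk_class_nil /holonomy big_nil.
rewrite holonomy_cons tree_cocycle_split // IH //.
by move: (cs); rewrite -cat_rcons => /closed_walk_open; rewrite last_rcons.
Qed.

(** The branches have trivial holonomy, so only the edge in the middle of the
    loop contributes. *)
Lemma holonomy_branch (G : groupType) (c : X -> X -> G) :
    cocycle e c -> (forall x, x != x0 -> c (p x) x = 1%g) ->
  forall x y, e x y -> pi1_holonomy c (tree_cocycle x y) = c x y.
Proof.
move=> cc ct x y xy; rewrite pi1_holonomyE ?closed_walk_edge //.
have up z : holonomy c x0 (tau z) = 1%g.
  elim/(tree_ind tree): z => [|z zx0 IH]; first by rewrite tree.1 /holonomy big_nil.
  have [_ ->] := tree.2 z zx0; rewrite -cats1 holonomy_cat IH (last_branch tree).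
  by rewrite holonomy_cons ct // /holonomy big_nil !mulg1.
have down z : holonomy c z (descent z) = 1%g.
  elim/(tree_ind tree): z => [|z zx0 IH].
    by rewrite (descent_root tree) /holonomy big_nil.
  have [ez _] := tree.2 z zx0.
  by rewrite (descentS tree) // holonomy_cons IH (cocycleV exx eC cc ez) ct // invg1 mulg1.
by rewrite holonomy_cat holonomy_cons up down mul1g mulg1 (last_branch tree).
Qed.

End TreeCocycle.

(** * Freeness from a cone elimination *)

Lemma connect_digital n (X : {fset 'rV[int]_n}) (x0 : X) :
  digital_connected x0 -> forall x, connect (@image_adj n X) x0 x.
Proof.
move=> conn x; have [N [a [ca <- <-]]] := conn x.
suff H i : i <= N -> connect (@image_adj n X) (a ord0) (a (inord i)).
  by rewrite -(inord_max N); exact: H.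
elim: i => [|i IH] iN; first by rewrite inord_ord0.
apply: connect_trans (IH (ltnW iN)) (connect1 _); apply: ca.
by rewrite /interval_adj !inordK; lia.
Qed.

(** This holds in every dimension; only the existence of an elimination ordering
    is special to the plane. *)
Theorem cone_elimination_free n (X : {fset 'rV[int]_n}) (x0 : X)
    (rank : X -> nat) (apex : X -> X -> X) :
    digital_connected x0 -> cone_elimination (@image_adj n X) rank apex ->
  is_free_group (pi1 x0).
Proof.
set e := @image_adj n X => conn elim.
have exx : reflexive e := @adjxx n X.
have eC : symmetric e := @image_adj_sym n X.
pose sk := skeleton e rank apex.
pose sk' := [rel x y | sk x y || sk y x].
have sk_e x y : sk x y -> e x y by move=> /andP[/andP[]].
have sk'_e x y : sk' x y -> e x y by move=> /orP[/sk_e//|/sk_e]; rewrite eC.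
have sk'C : connect_sym sk' by apply: sym_connect_sym => x y; rewrite /= orbC.
have conn_sk x : connect sk' x0 x.
  have : subrel e (connect sk').
    move=> y z; elim/(skeleton_ind eC elim): y z /.
    - by move=> y; exact: connect0.
    - by move=> y z; rewrite sk'C.
    - by move=> y z t _ _ _; exact: connect_trans.
    - by move=> v w vw; apply: connect1; rewrite /= /sk vw.
  by move=> /connect_sub; apply; exact: connect_digital.
have [p [tau tree']] := spanning_tree conn_sk.
have tree : rooted_tree e x0 p tau.
  by split=> [|x /tree'.2[/sk'_e]]; first exact: tree'.1.
pose in_tree (x y : X) := (x != x0) && (p x == y).
pose basis := {xy : X * X | sk xy.1 xy.2 && ~~ (in_tree xy.1 xy.2 || in_tree xy.2 xy.1)}.
exists basis, (fun i => tree_cocycle x0 tau (val i).1 (val i).2) => H f; split.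
  (* The edges of the tree fall outside the basis, so that g is 1 on them. *)
  pose g x y : H := if insub (x, y) is Some i then f (i : basis) else 1%g.
  have [c [cc cg]] := skeleton_cocycle g exx eC elim.
  have c_tree x : x != x0 -> c (p x) x = 1%g.
    move=> xx0; have [skp _] := tree'.2 x xx0.
    have xp : in_tree x (p x) by rewrite /in_tree xx0 eqxx.
    have /orP[h|h] := skp; first by rewrite cg // /g insubN //= xp orbT andbF.
    by rewrite (cocycleV exx eC cc (sk_e _ _ h)) cg // /g insubN ?invg1 //= xp andbF.
  pose phi := HB.pack_for (UMagmaMorphism.type (pi1 x0) H) (pi1_holonomy (x0 := x0) c)
     (isUMagmaMorphism.Build _ _ _ (pi1_holonomy_morph x0 cc)).
  exists phi => -[[x y] /= sxy]; have [skxy _] := andP sxy.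
  by rewrite (holonomy_branch tree cc c_tree (sk_e _ _ skxy)) cg // /g insubT.
move=> phi psi hphi hpsi u; have [s cs ->] := walk_class_surj u.
rewrite -(holonomy_tree_cocycle tree cs); have /andP[ps _] := cs.
have agree x y : e x y -> phi (tree_cocycle x0 tau x y) = psi (tree_cocycle x0 tau x y).
  have tc := tree_cocycleP tree.
  have push (chi : UMagmaMorphism.type (pi1 x0) H) :
      cocycle e (fun x y => chi (tree_cocycle x0 tau x y)).
    by move=> a b d ab bd ad; rewrite -gmulfM tc.
  apply: (cocycle_uniq exx eC elim (push phi) (push psi)) => {}x {}y skxy.
  have [|ntree] := boolP (in_tree x y || in_tree y x).
    case/orP=> /andP[nx0 /eqP <-]; last by rewrite (tree_cocycle_tree tree) // !gmulf1.
    have [ep _] := tree.2 x nx0.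
    by rewrite (cocycleV exx eC tc ep) (tree_cocycle_tree tree) // invg1 !gmulf1.
  have sxy : sk (x, y).1 (x, y).2 &&
      ~~ (in_tree (x, y).1 (x, y).2 || in_tree (x, y).2 (x, y).1).
    by rewrite /= /sk skxy.
  by rewrite (hphi (exist _ (x, y) sxy)) (hpsi (exist _ (x, y) sxy)).
have walk_agree x t : path e x t ->
    phi (holonomy (tree_cocycle x0 tau) x t) = psi (holonomy (tree_cocycle x0 tau) x t).
  elim: t x => [|y t IH] x /=; first by rewrite /holonomy big_nil !gmulf1.
  by move=> /andP[exy pt]; rewrite holonomy_cons !gmulfM agree // IH.
exact: walk_agree.
Qed.

(** * The sweep of the plane *)

Section Planar.
Context (X : {fset 'rV[int]_2}).
Local Notation e := (@image_adj 2 X).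

Definition xpos (v : X) : int := val v ord0 ord0.
Definition ypos (v : X) : int := val v ord0 ord_max.

Lemma ord2P (i : 'I_2) : i = ord0 \/ i = ord_max.
Proof. by case: i => [[|[|//]] lt]; [left|right]; apply: val_inj. Qed.

Lemma planar_adjE v w :
  e v w = (`|xpos v - xpos w| <= 1)%R && (`|ypos v - ypos w| <= 1)%R.
Proof.
apply/forallP/andP => [h|[hx hy] i]; first by split; apply: h.
by case: (ord2P i) => ->.
Qed.

Lemma pos_inj v w : xpos v = xpos w -> ypos v = ypos w -> v = w.
Proof.
move=> hx hy; apply: val_inj; apply/rowP => i.
by case: (ord2P i) => ->.
Qed.

(** The shift that makes [2 x + y] nonnegative on the finite set [X], since ranks
    are natural numbers. *)
Definition sweep_bound : nat := \max_(v : X) (2 * `|xpos v| + `|ypos v|)%N.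

Definition sweep (v : X) : nat := `|(2 * xpos v + ypos v + sweep_bound%:Z)%R|%N.

Lemma sweep_lt v w :
  (sweep v < sweep w) = (2 * xpos v + ypos v < 2 * xpos w + ypos w)%R.
Proof.
have bound u : 2 * `|xpos u| + `|ypos u| <= sweep_bound by exact: (leq_bigmax u).
by move: (bound v) (bound w); rewrite /sweep; lia.
Qed.

Definition at_offset (v : X) (dx dy : int) : option X :=
  [pick w : X | (xpos w == xpos v + dx)%R && (ypos w == ypos v + dy)%R].

(** For [w] among the earlier neighbours A, B, C, D of [v], the test
    [ypos w <= ypos v] excludes exactly D, which is not adjacent to A. *)
Definition sweep_apex (v w : X) : X :=
  if at_offset v (-1) 0 is Some c then c
  else if at_offset v 0 (-1) is Some a then
    if (ypos w <= ypos v)%R then a else w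
  else w.

(** Ranks separate neighbours because [2 dx + dy] vanishes on no nonzero offset
    with entries in -1, 0, 1. *)
Lemma sweep_cone_elimination : cone_elimination e sweep sweep_apex.
Proof.
have eqsw v w : sweep v = sweep w -> (2 * xpos v + ypos v = 2 * xpos w + ypos w)%R.
  by have := sweep_lt v w; have := sweep_lt w v; lia.
split=> [v w|v w|v w w'].
- rewrite planar_adjE => /andP[hx hy] /eqsw h; apply: pos_inj; lia.
- rewrite /earlier !planar_adjE !sweep_lt /sweep_apex /at_offset.
  case: pickP => [c /andP[/eqP cx /eqP cy]|nc].
    by lia.
  case: pickP => [a /andP[/eqP ax /eqP ay]|na].
    by case: ifP; lia.
  by lia.
- rewrite /earlier !planar_adjE !sweep_lt /sweep_apex /at_offset.
  case: pickP => // nc.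
  have {}nc u : ~ ((xpos u = xpos v - 1)%R /\ (ypos u = ypos v)%R).
    by move=> [ux uy]; have := nc u; rewrite ux uy GRing.addr0 !eqxx.
  have := nc w; have := nc w'.
  case: pickP => [a /andP[/eqP ax /eqP ay]|na].
    case: ifP => h; case: ifP => h' //.
    + lia.
    + lia.
    + by move=> ? ? ? ? ?; apply: pos_inj; lia.
  have {}na u : ~ ((xpos u = xpos v)%R /\ (ypos u = ypos v - 1)%R).
    by move=> [ux uy]; have := na u; rewrite ux uy GRing.addr0 !eqxx.
  have := na w; have := na w' => ? ? ? ? ? ? ?; apply: pos_inj; lia.
Qed.

End Planar.

Theorem theorem6p6 (X : {fset 'rV[int]_2}) (x0 : X)
    (X_connected : digital_connected x0) :
  is_free_group (pi1 x0).
Proof. exact: cone_elimination_free X_connected (sweep_cone_elimination X). Qed.
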